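(* Let $G$ be a graph, let $\Delta=\Delta(G)$ be its maximum degree, and let $t_i$ denote the number of vertices of $G$ of degree $i$. Then $$\mathrm{es}_{\chi'}(G)\leq t_\Delta+\frac{t_{\Delta-1}}{2}.$$ Furthermore, equality holds if and only if $t_{\Delta-1}=0$ and the subgraph $G_\Delta$ of $G$ induced by the vertices of degree $\Delta$ has no edges.
   Context: All graphs are finite, simple (no loops or multiple edges) and have at least one edge. The chromatic index $\chi'(G)$ is the minimum number of colors in a proper edge coloring of $G$ (incident edges receive different colors); an edgeless graph, which may arise after deleting edges, has chromatic index $0$. The chromatic edge stability index $\mathrm{es}_{\chi'}(G)$ is the minimum number of edges of $G$ whose removal (keeping all vertices) results in a graph $H$ with $\chi'(H)=\chi'(G)-1$; equivalently, the minimum size of a set $F\subseteq E(G)$ with $\chi'(G\setminus F)<\chi'(G)$. *)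

(* Defs.v *)
From mathcomp Require Import all_boot.

Set Implicit Arguments.
Unset Strict Implicit.
Unset Printing Implicit Defensive.

(* A finite simple graph: each edge is the set of its two distinct endpoints. *)
Record sgraph := SGraph {
  vertex : finType;
  edges : {set {set vertex}};
  card_edge : forall f : {set vertex}, f \in edges -> #|f| = 2
}.

Definition degree (G : sgraph) (v : vertex G) : nat :=
  #|[set f in edges G | v \in f]|.

Definition max_degree (G : sgraph) : nat := \max_(v : vertex G) degree v.

Definition vertices_of_degree (G : sgraph) (i : nat) : {set vertex G} :=
  [set v | degree v == i].

Definition num_degree (G : sgraph) (i : nat) : nat :=
  #|vertices_of_degree G i|.

(* Edge set of the subgraph induced by S. *)
Definition induced_edges (G : sgraph) (S : {set vertex G}) :
    {set {set vertex G}} :=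
  [set f in edges G | f \subset S].

Lemma card_edgeD (G : sgraph) (F : {set {set vertex G}}) :
  forall f, f \in edges G :\: F -> #|f| = 2.
Proof. by move=> f /setDP[fG _]; exact: card_edge fG. Qed.

Definition del_edges (G : sgraph) (F : {set {set vertex G}}) : sgraph :=
  SGraph (card_edgeD (F := F)).

Definition edge (G : sgraph) : finType :=
  {f : {set vertex G} | f \in edges G}.

(* Colorings are functions on the subtype of edges, so that a graph without   *)
(* edges is colorable with 0 colors.                                          *)
Definition proper_edge_coloring (G : sgraph) (k : nat)
    (c : {ffun edge G -> 'I_k}) : bool :=
  [forall f : edge G, forall g : edge G,
     (f != g) && ~~ [disjoint val f & val g] ==> (c f != c g)].

Definition edge_colorable (G : sgraph) (k : nat) : bool :=
  [exists c : {ffun edge G -> 'I_k},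
     proper_edge_coloring c].

Lemma edge_colorableP (G : sgraph) (k : nat) :
  reflect (exists c : {set vertex G} -> nat,
             (forall f, f \in edges G -> c f < k) /\
             (forall f g, f \in edges G -> g \in edges G ->
                f != g -> ~~ [disjoint f & g] -> c f != c g))
          (edge_colorable G k).
Proof.
apply: (iffP existsP) => [[c /forallP c_proper]|[c [c_lt c_proper]]].
  exists (fun f => if insub f is Some u then nat_of_ord (c u) else 0); split.
    by move=> f fG; rewrite insubT.
  move=> f g fG gG fg Nd; rewrite !insubT /=.
  have /forallP/(_ (Sub g gG))/implyP := c_proper (Sub f fG).
  by rewrite -val_eqE /= fg Nd => /(_ isT).
exists [ffun u => Ordinal (c_lt (val u) (valP u))].
apply/forallP => f; apply/forallP => g; apply/implyP => /andP[fg Nd].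
by rewrite !ffunE -val_eqE /=; apply: c_proper => //; exact: valP.
Qed.

Lemma edge_colorable_exists (G : sgraph) : exists k, edge_colorable G k.
Proof.
exists #|{set vertex G}|; apply/edge_colorableP.
exists (fun f => nat_of_ord (enum_rank f)); split=> // f g _ _ fg _.
by rewrite val_eqE (inj_eq enum_rank_inj).
Qed.

Definition chromatic_index (G : sgraph) : nat :=
  ex_minn (edge_colorable_exists G).

(* For a graph with at least one edge the chromatic index is positive, so the *)
(* predecessor below is a genuine subtraction of 1.                           *)
Definition stability_witness (G : sgraph) (F : {set {set vertex G}}) : bool :=
  (F \subset edges G) &&
  (chromatic_index (del_edges F) == (chromatic_index G).-1).

Lemma stability_witness_exists (G : sgraph) :
  exists m, [exists F : {set {set vertex G}},
               stability_witness F && (#|F| == m)].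
Proof.
suff [F wF] : exists F : {set {set vertex G}}, stability_witness F.
  by exists #|F|; apply/existsP; exists F; rewrite wF eqxx.
rewrite /stability_witness {2}/chromatic_index.
case: ex_minnP => k /edge_colorableP[c [c_lt c_proper]] k_min.
exists [set f in edges G | c f == k.-1]; set F := [set f in _ | _].
apply/andP; split; first by apply/subsetP => f; rewrite inE => /andP[].
have inD f : f \in edges (del_edges F) -> (f \in edges G) * (c f != k.-1).
  rewrite /= !inE => /andP[+ fG]; rewrite fG /= => fk.
  by split.
rewrite /chromatic_index; case: ex_minnP => j jP j_min.
rewrite eqn_leq; apply/andP; split.
  apply: j_min; apply/edge_colorableP; exists c; split.
    move=> f /inD[fG fk]; have := c_lt f fG.
    by case: (k) fk => // k' fk; rewrite ltnS leq_eqVlt (negPf fk).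
  by move=> f g /inD[fG _] /inD[gG _]; exact: c_proper.
suff : k <= j.+1 by case: (k).
apply: k_min; apply/edge_colorableP.
have /edge_colorableP[d [d_lt d_proper]] := jP.
have outF f : f \in edges G -> f \notin F -> f \in edges (del_edges F).
  by move=> fG fF; apply/setDP.
exists (fun f => if f \in F then j else d f); split.
  by move=> f fG; case: ifPn => // fF; apply/ltnW; rewrite ltnS d_lt ?outF.
move=> f g fG gG fg Nd; case: ifPn => fF; case: ifPn => gF.
- have := c_proper f g fG gG fg Nd.
  by move: fF gF; rewrite !inE => /andP[_ /eqP->] /andP[_ /eqP->]; rewrite eqxx.
- by rewrite gtn_eqF ?d_lt ?outF.
- by rewrite ltn_eqF ?d_lt ?outF.
- by apply: d_proper => //; exact: outF.
Qed.

Definition edge_stability_index (G : sgraph) : nat :=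
  ex_minn (stability_witness_exists G).

(* Main.v *)
Require Import Defs.
From mathcomp Require Import all_boot all_order all_algebra.
From mathcomp Require Import perm zify lra.

Set Implicit Arguments.
Unset Strict Implicit.
Unset Printing Implicit Defensive.

Import Order.TTheory GRing.Theory Num.Theory.

(** Write [D] for the maximum degree, [tD] and [tD1] for the numbers of vertices
    of degree [D] and [D - 1].  As the chromatic index is at least [D], it is
    enough to delete edges until [D - 1] colours suffice
    ([edge_stability_index_le]).  The colouring tool is the case of Fournier's
    theorem where the vertices of degree [k], in a graph of maximum degree at
    most [k], are independent: such a graph is [k]-edge-colourable
    ([independent_core_colorable]).  It follows from Schrijver's extension lemma
    ([vertex_extension]): a colouring of the edges that avoid a vertex [v]
    extends to all edges if [v] and its neighbours have degree at most [k], and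
    at most one neighbour has degree [k].

    Upper bound ([maximal_deletion]).  Give demand 2 to the vertices of degree
    [D] and demand 1 to those of degree [D - 1], and let [F] be a maximal set of
    edges whose degrees do not exceed the demands.  Vertices with an unmet demand
    are pairwise nonadjacent outside [F].  Delete [F] and one edge at each vertex
    of degree [D] that [F] misses; the vertices whose degree is still [D - 1]
    have an unmet demand, hence are independent, and [D - 1] colours suffice.
    Each deleted edge uses up two units of demand, so twice the number of deleted
    edges is at most the total demand [2 tD + tD1].

    Equality.  If [tD1 > 0] or two vertices of degree [D] are adjacent, one can
    do strictly better ([saving_deletion]): either some demand is wasted, or some
    edge of [F] can be put back by one more use of the extension lemma.
    Conversely, if the vertices of degree [D] are independent, then the chromatic
    index is [D], every witness has an edge at each of these vertices, and these
    edges are distinct ([independent_core_stability_ge]). *)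

(** * Kempe swaps on families of matchings *)

(** The colour classes [f] and [g] are matchings, written as involutions whose
    fixed points are the unmatched vertices; [C] is the Kempe component of [u],
    a path or an isolated vertex because [u] is unmatched in [f].  Since [f]
    conjugates [p := f \o g] to its inverse, [f (p^n u) = p^-n u]: the [p]-orbit
    of [u] is closed under both involutions, and [p^n u] is fixed by [f] exactly
    when [p^(2n)] fixes [u], which leaves at most two points of the orbit. *)
Lemma kempe_component (T : finType) (f g : T -> T) (u : T) :
    involutive f -> involutive g -> f u = u ->
  exists C : {set T},
    [/\ forall x, (f x \in C) = (x \in C), forall x, (g x \in C) = (x \in C),
        u \in C & #|[set x in C | f x == x]| <= 2].
Proof.
move=> fK gK fu.
pose p := perm (inj_comp (can_inj fK) (can_inj gK)).
have pE x : p x = f (g x) by rewrite permE.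
have pVE x : (p^-1)%g x = g (f x) by rewrite -[RHS](permK p) pE gK fK.
have fp n : f ((p ^+ n)%g u) = (p ^- n)%g u.
  elim: n => [|n IHn]; first by rewrite expg0 invg1 !perm1.
  have Eq : (p ^+ n)%g u = f ((p ^- n)%g u) by rewrite -IHn fK.
  by rewrite expgSr permM pE fK {1}Eq -pVE -permM -invgM -expgS -expgSr.
have fC x : x \in porbit p u -> f x \in porbit p u.
  by move=> /porbitP[n ->]; rewrite fp -porbitV -expVgn mem_porbit.
have gC x : x \in porbit p u -> g x \in porbit p u.
  move=> xC; rewrite -(fK (g x)) -pE; apply: fC.
  by move: xC => /porbitP[n ->]; rewrite -permM -expgSr mem_porbit.
have clos (h : T -> T) : involutive h -> 
    (forall x, x \in porbit p u -> h x \in porbit p u) ->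
    forall x, (h x \in porbit p u) = (x \in porbit p u).
  by move=> hK hC x; apply/idP/idP => [/hC|/hC//]; rewrite hK.
exists (porbit p u); split=> //; try exact: clos; first exact: porbit_id.
set m := #|porbit p u|.
have iter_inj a b : a < m -> b < m -> iter a p u = iter b p u -> a = b.
  move=> am bm eab; apply/eqP.
  rewrite -(nth_uniq u _ _ (uniq_traject_porbit p u)) ?size_traject //.
  by rewrite !nth_traject // eab.
have sub : [set x in porbit p u | f x == x] \subset [set u; iter m./2 p u].
  apply/subsetP => w; rewrite inE porbit_traject => /andP[].
  move=> /trajectP[n nm Ew] /eqP fw.
  have n2 : iter (n + n) p u = u.
    move: fw; rewrite Ew -!permX fp => /(congr1 (p ^+ n)%g).
    by rewrite permKV -permM -expgnDr.
  (* For n below the orbit size m, p^(2n) u = u forces 2n = 0 or 2n = m. *)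
  have [lt2|ge2] := ltnP (n + n) m.
    have := iter_inj _ 0 lt2 (leq_ltn_trans (leq0n _) nm) n2.
    by case: (n) Ew => [|//] ->; rewrite !inE eqxx.
  have : iter (n + n - m) p u = iter 0 p u.
    by rewrite -[in LHS](iter_porbit p u) -iterD subnK.
  move=> /iter_inj E0; have {}E0: n + n - m = 0 by apply: E0; lia.
  by rewrite Ew (_ : m./2 = n) ?inE ?eqxx ?orbT //; lia.
by apply: leq_trans (subset_leq_card sub) _; rewrite cards2; case: eqP.
Qed.

(** A recolouring that permutes, at each vertex separately, the colours of [A].
    Applied to a family of matchings, it keeps the set of edges at each vertex;
    applied to a family of vertex sets, the number of those containing it. *)
Definition color_permuted (T K : finType) (S : Type) (A : {set K})
    (s s' : K -> T -> S) : Prop :=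
  forall u, exists2 pi : {perm K}, perm_on A pi & forall i, s' i u = s (pi i) u.

Lemma color_permuted_refl (T K : finType) (S : Type) (A : {set K})
  (s : K -> T -> S) : color_permuted A s s.
Proof. by move=> u; exists 1%g => [|i]; [exact: perm_on1 | rewrite perm1]. Qed.

Lemma color_permuted_trans (T K : finType) (S : Type) (A B : {set K})
    (s1 s2 s3 : K -> T -> S) :
    B \subset A -> color_permuted A s1 s2 -> color_permuted B s2 s3 ->
  color_permuted A s1 s3.
Proof.
move=> sBA r12 r23 u; have [a aA E12] := r12 u; have [b bB E23] := r23 u.
exists (b * a)%g => [|i]; last by rewrite E23 E12 permM.
by apply: perm_onM => //; apply: subset_trans bB sBA.
Qed.

Lemma color_permuted_card (T K : finType) (A : {set K}) (X X' : K -> T -> bool)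
    (u : T) : color_permuted A X X' ->
  #|[set i in A | X' i u]| = #|[set i in A | X i u]|.
Proof.
move=> /(_ u)[a aA E].
rewrite -(card_preimset [set i in A | X i u] (@perm_inj _ a)).
by apply: eq_card => i; rewrite !inE E perm_closed.
Qed.

(** Exchanging the colours [i] and [j] on [C].  The codomain is arbitrary so
    that the same swap acts on matchings and on the sets of vertices at which
    colours are declared free. *)
Definition kempe_swap (T K : finType) (S : Type) (i j : K) (C : {set T})
    (s : K -> T -> S) : K -> T -> S :=
  fun l u => s (if u \in C then tperm i j l else l) u.

Lemma color_permuted_swap (T K : finType) (S : Type) (A : {set K}) (i j : K)
    (C : {set T}) (s : K -> T -> S) :
  i \in A -> j \in A -> color_permuted A s (kempe_swap i j C s).
Proof.
move=> iA jA u; exists (if u \in C then tperm i j else 1%g) => [|l]; last first.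
  by rewrite /kempe_swap; case: ifP; rewrite ?perm1.
case: ifP => _; last exact: perm_on1.
by apply: subset_trans (tperm_on i j) _; rewrite subUset !sub1set iA.
Qed.

Lemma kempe_swap_involutive (T K : finType) (i j : K) (C : {set T})
    (m : K -> T -> T) :
    (forall l, involutive (m l)) ->
    (forall x, (m i x \in C) = (x \in C)) ->
    (forall x, (m j x \in C) = (x \in C)) ->
  forall l, involutive (kempe_swap i j C m l).
Proof.
move=> mK iC jC l x; rewrite /kempe_swap.
have [<-|il] := eqVneq i l.
  by rewrite tpermL; case: (boolP (x \in C)) => xC;
    rewrite ?iC ?jC ?xC ?(negPf xC) mK.
have [<-|jl] := eqVneq j l.
  by rewrite tpermR; case: (boolP (x \in C)) => xC;
    rewrite ?iC ?jC ?xC ?(negPf xC) mK.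
by rewrite tpermD // !if_same mK.
Qed.

(** [X l] is a set of vertices at which the colour [l] is free.  If no [X l] is
    a singleton, the total being less than twice the number of colours leaves
    some [X j] empty, and its oddness gives some [X i] at least 3 elements.
    Swapping [i] and [j] on the Kempe component of a vertex of [X i] moves one
    or two elements from [X i] to [X j], by [kempe_component], and this lowers
    the sum of the squares of the sizes. *)
Lemma kempe_balance (T K : finType) (A : {set K}) (m : K -> T -> T)
    (X : K -> T -> bool) :
    (forall l, involutive (m l)) -> (forall l u, X l u -> m l u = u) ->
    odd (\sum_(l in A) #|X l|) -> \sum_(l in A) #|X l| < #|A|.*2 ->
  exists (m' : K -> T -> T) (X' : K -> T -> bool) (i : K),
    [/\ forall l, involutive (m' l), forall l u, X' l u -> m' l u = u,
        color_permuted A m m', color_permuted A X X' & i \in A /\ #|X' i| = 1].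
Proof.
have [n] := ubnP (\sum_(l in A) #|X l| ^ 2).
elim: n => // n IHn in m X * => le_n mK Xm Xodd Xlt.
have [/existsP[i /andP[iA /eqP Xi]]|no1] := boolP [exists i in A, #|X i| == 1].
  by exists m, X, i; split=> //; exact: color_permuted_refl.
have n1 l : l \in A -> #|X l| != 1.
  by move=> lA; apply: contra no1 => Xl; apply/existsP; exists l; rewrite lA.
have [j jA Xj] : exists2 j, j \in A & #|X j| = 0.
  have [/exists_inP[j jA /eqP Xj]|/exists_inPn no0] :=
    boolP [exists j in A, #|X j| == 0]; first by exists j.
  move: Xlt; rewrite ltnNge -muln2 -sum_nat_const leq_sum // => l lA.
  by have := n1 l lA; have := no0 l lA; lia.
have [i iA Xi] : exists2 i, i \in A & 2 < #|X i|.
  have [/exists_inP[i iA Xi]|/exists_inPn no3] :=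
    boolP [exists i in A, 2 < #|X i|]; first by exists i.
  move: Xodd; rewrite -[odd _]negbK -dvdn2 dvdn_sum // => l lA.
  by have := n1 l lA; have := no3 l lA; case: #|_| => [|[|[|]]].
have ij : j != i by apply: contraTneq Xi => <-; rewrite Xj.
have X0 u : X j u = false by have /pred0P/(_ u) : #|X j| == 0 by apply/eqP.
have /card_gt0P[u Xu] : 0 < #|X i| by lia.
have [C [iC jC uC leC]] := kempe_component (mK i) (mK j) (Xm i u Xu).
pose m' := kempe_swap i j C m; pose X' := kempe_swap i j C X.
set a := #|[set x in C | X i x]|.
have a_gt0 : 0 < a by apply/card_gt0P; exists u; rewrite inE uC.
have a_le2 : a <= 2.
  apply: leq_trans leC; apply/subset_leq_card/subsetP => x.
  by rewrite !inE => /andP[-> /Xm->] /=.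
have X'j : #|X' j| = a.
  apply: eq_card => x; rewrite !inE /X' /kempe_swap unfold_in tpermR.
  by case: ifP; rewrite ?X0.
have X'i : #|X' i| + a = #|X i|.
  rewrite addnC -[RHS](cardID (mem C) (X i)); congr (_ + _).
    by apply: eq_card => x; rewrite !inE andbC.
  apply: eq_card => x; rewrite !inE /X' /kempe_swap unfold_in tpermL.
  by case: ifP; rewrite ?X0.
have X'l l : (l != i) -> (l != j) -> #|X' l| = #|X l|.
  move=> li lj; apply: eq_card => x.
  by rewrite /X' /kempe_swap /in_mem /= tpermD 1?eq_sym // if_same.
have sumE (h : nat -> nat) (Y : K -> T -> bool) :
    \sum_(l in A) h #|Y l| =
    h #|Y i| + h #|Y j| + \sum_(l in A | (l != i) && (l != j)) h #|Y l|.
  rewrite (bigD1 i) //= (bigD1 j) ?jA //= addnA; congr (_ + _).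
  by apply: eq_bigl => l; rewrite andbA.
have rest h : \sum_(l in A | (l != i) && (l != j)) h #|X' l| =
    \sum_(l in A | (l != i) && (l != j)) h #|X l|.
  by apply: eq_bigr => l /and3P[_ li lj]; rewrite X'l.
have sumX' : \sum_(l in A) #|X' l| = \sum_(l in A) #|X l|.
  by rewrite !(sumE id) (rest id) X'j Xj X'i addn0.
(* With x = #|X i| >= 3 and 0 < a <= 2, (x - a)^2 + a^2 < x^2 since a < x. *)
have [||||| m2 [X2 [k [m2K X2m rm rX kP]]]] := IHn m' X'.
- rewrite (leq_trans _ (ltnSE le_n)) // !(sumE (expn^~ 2)) /= (rest (expn^~ 2)).
  by rewrite X'j Xj -X'i; nia.
- exact: kempe_swap_involutive.
- by rewrite /X' /m' /kempe_swap => l x /Xm.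
- by rewrite sumX'.
- by rewrite sumX'.
exists m2, X2, k; split=> //.
  exact: color_permuted_trans (subxx _) (color_permuted_swap _ _ iA jA) rm.
exact: color_permuted_trans (subxx _) (color_permuted_swap _ _ iA jA) rX.
Qed.

(** * Distinct missing colours *)

Definition missing (T K : finType) (A : {set K}) (m : K -> T -> T) (u : T) :
    {set K} :=
  [set l in A | m l u == u].

Lemma subset_card_exists (T : finType) (A : {set T}) (n : nat) :
  n <= #|A| -> exists2 B : {set T}, B \subset A & #|B| = n.
Proof.
move=> /card_geqP[s [s_uniq sz sA]]; exists [set x in s].
  by apply/subsetP => x; rewrite inE => /sA.
by rewrite cardsE -sz; apply/card_uniqP.
Qed.

(** Schrijver's form of Vizing's argument.  Every vertex of [N] misses two
    colours, except perhaps [y], which misses one; after a recolouring, the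
    vertices of [N] can be given distinct missing colours.  Keep exactly two
    missing colours at each vertex and one at [y]: these choices number
    [2 #|N| - 1], odd and less than [2 #|A|], so [kempe_balance] makes some
    colour [i] chosen at a single vertex [u].  Give [i] to [u], and freeze [i]:
    the other vertices of [N] lose none of their chosen colours, and induction
    applies to [A :\ i] and [N :\ u].  The function [g] sends a colour to the
    vertex that receives it. *)
Lemma distinct_missing_colors (T K : finType) (A : {set K}) (N : {set T})
    (y : T) (m : K -> T -> T) :
    (forall l, involutive (m l)) -> #|N| <= #|A| ->
    {in N, forall u, 0 < #|missing A m u|} ->
    {in N, forall u, u != y -> 1 < #|missing A m u|} ->
  exists (m' : K -> T -> T) (g : K -> option T),
    [/\ forall l, involutive (m' l), color_permuted A m m',
        {in N, forall u, exists l, g l = Some u} &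
        forall l u, g l = Some u -> [/\ l \in A, u \in N & m' l u = u]].
Proof.
have [n] := ubnP #|N|; elim: n => // n IHn in A N y m * => le_n mK leNA mis1 mis2.
have [N0|[y0 y0N]] := set_0Vmem N.
  exists m, (fun=> None); split=> //; first exact: color_permuted_refl.
  by move=> u; rewrite N0 inE.
(* z is the vertex at which a single colour is kept: it must lie in N for the
   number of choices to be odd. *)
pose z := if y \in N then y else y0.
have zN : z \in N by rewrite /z; case: ifP.
have mis2z : {in N, forall u, u != z -> 1 < #|missing A m u|}.
  move=> u uN uz; apply: mis2 => //; apply: contraNneq uz => uy.
  by rewrite /z -uy uN.
have /fin_all_exists[Y YP] u : exists Y : {set K}, u \in N ->
    Y \subset missing A m u /\ #|Y| = if u == z then 1 else 2.
  have [uN|_] := boolP (u \in N); last by exists set0.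
  have [|Y sY cY] := @subset_card_exists _ (missing A m u) (if u == z then 1 else 2).
    by case: eqVneq => uz; [exact: mis1 | exact: mis2z].
  by exists Y.
pose X l u := (u \in N) && (l \in Y u).
have Xm l u : X l u -> m l u = u.
  by move=> /andP[/YP[/subsetP sY _] /sY]; rewrite inE => /andP[_ /eqP].
have cardX u : u \in N -> #|[set l in A | X l u]| = if u == z then 1 else 2.
  move=> uN; have [/subsetP sY <-] := YP u uN; apply: eq_card => l.
  rewrite !inE /X uN /=; case: (boolP (l \in Y u)) => [/sY|]; rewrite ?andbF //.
  by rewrite inE => /andP[->].
have sumX : (\sum_(l in A) #|X l|).+1 = #|N|.*2.
  have -> : \sum_(l in A) #|X l| = \sum_(u in N) #|[set l in A | X l u]|.
    under eq_bigr => l _ do rewrite -sum1_card.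
    under [RHS]eq_bigr => u _ do rewrite -sum1_card.
    rewrite (exchange_big_dep (mem N)) /=; last by move=> l u _ /andP[].
    by apply: eq_bigr => u uN; apply: eq_bigl => l; rewrite !inE.
  rewrite (bigD1 z) //= cardX // eqxx (cardsD1 z N) zN doubleD -addSn.
  rewrite -(muln2 #|_|) -sum_nat_const; congr (_ + _).
  rewrite [RHS](eq_bigl (fun u => (u \in N) && (u != z))).
    by apply: eq_bigr => u /andP[uN uz]; rewrite cardX // (negPf uz).
  by move=> u; rewrite !inE andbC.
have [||m1 [X1 [i [m1K X1m rm rX [iA /eqP/card1P[u X1i]]]]]] :=
  @kempe_balance T K A m X mK Xm.
- by have := congr1 odd sumX; rewrite /= odd_double; case: odd.
- by move: leNA; rewrite -leq_double -sumX.
have X1u : X1 i u by have := X1i u; rewrite !inE eqxx.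
have X1N l w : X1 l w -> w \in N.
  by have [pi _ ->] := rX w; case/andP.
have miss1 w : w \in N :\ u ->
    (if w == z then 1 else 2) <= #|missing (A :\ i) m1 w|.
  rewrite !inE => /andP[wu wN]; rewrite -cardX // -(color_permuted_card _ rX).
  apply/subset_leq_card/subsetP => l; rewrite !inE => /andP[-> Xlw].
  rewrite (X1m _ _ Xlw) eqxx !andbT; apply: contra_neq wu => li.
  by apply/eqP; have := X1i w; rewrite !inE -li => <-.
have uN := X1N _ _ X1u.
have [|||||m2 [g [m2K rm2 gN gP]]] := IHn (A :\ i) (N :\ u) z m1.
- by move: le_n; rewrite (cardsD1 u N) uN ltnS.
- by [].
- by move: leNA; rewrite (cardsD1 u N) (cardsD1 i A) uN iA.
- by move=> w /miss1; case: ifP => _ // /ltnW.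
- by move=> w /miss1 + /negPf wz; rewrite wz.
exists m2, (fun l => if l == i then Some u else g l); split=> //.
- exact: color_permuted_trans (subD1set _ _) rm rm2.
- move=> w wN; have [->|wu] := eqVneq w u; first by exists i; rewrite eqxx.
  have [|l gl] := gN w; first by rewrite !inE wu.
  by exists l; have [] := gP _ _ gl; rewrite !inE => /andP[/negPf->].
move=> l w; have [-> [<-]|_ /gP[]] := eqVneq l i; last first.
  by rewrite !inE => /andP[_ ->] /andP[_ ->].
have [pi pi_on E] := rm2 u; split=> //.
by rewrite E (out_perm pi_on) ?X1m // !inE eqxx.
Qed.

(** * Edge colourings and the extension lemma *)

(** Edge sets over a fixed vertex type stand for graphs from here on, so that
    deleting edges does not change the type of the vertices. *)
Definition simple (T : finType) (E : {set {set T}}) : Prop :=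
  forall f, f \in E -> #|f| = 2.

Definition deg (T : finType) (E : {set {set T}}) (v : T) : nat :=
  #|[set f in E | v \in f]|.

Definition colorable (T : finType) (E : {set {set T}}) (k : nat) : Prop :=
  exists c : {set T} -> nat,
    (forall f, f \in E -> c f < k) /\
    (forall f g, f \in E -> g \in E -> f != g -> ~~ [disjoint f & g] ->
       c f != c g).

Lemma simple_sub (T : finType) (E F : {set {set T}}) :
  F \subset E -> simple E -> simple F.
Proof. by move=> /subsetP sFE sE f /sFE /sE. Qed.

Lemma deg_sub (T : finType) (E F : {set {set T}}) (v : T) :
  F \subset E -> deg F v <= deg E v.
Proof.
move=> /subsetP sFE; apply/subset_leq_card/subsetP => f.
by rewrite !inE => /andP[/sFE-> ->].
Qed.

Lemma colorable_sub (T : finType) (E F : {set {set T}}) (k : nat) :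
  F \subset E -> colorable E k -> colorable F k.
Proof.
move=> /subsetP sFE [c [c_lt c_proper]]; exists c; split.
  by move=> f /sFE /c_lt.
by move=> f g /sFE fE /sFE gE; apply: c_proper.
Qed.

Lemma colorable_le (T : finType) (E : {set {set T}}) (k l : nat) :
  k <= l -> colorable E k -> colorable E l.
Proof.
move=> kl [c [c_lt c_proper]]; exists c; split=> // f fE.
exact: leq_trans (c_lt f fE) kl.
Qed.

Lemma pair_edge (T : finType) (E : {set {set T}}) (f : {set T}) (x : T) :
  simple E -> f \in E -> x \in f -> exists2 y, y != x & f = [set x; y].
Proof.
move=> sE fE xf; have /eqP/cards2P[a [b [ab fab]]] := sE f fE.
move: xf; rewrite fab !inE => /orP[]/eqP->; last by exists a; rewrite // setUC.
by exists b; rewrite // eq_sym.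
Qed.

Lemma loop_notin (T : finType) (E : {set {set T}}) (x y : T) :
  simple E -> [set x; y] \in E -> x != y.
Proof.
by move=> sE /sE; rewrite cards2; case: eqP.
Qed.

(** The involution [m i] exchanges the ends of every edge of colour [i]. *)
Lemma coloring_to_matchings (T : finType) (E : {set {set T}}) (k : nat) :
    simple E -> colorable E k ->
  exists m : 'I_k -> T -> T,
    [/\ forall i, involutive (m i),
        forall f x, f \in E -> x \in f -> exists i, f = [set x; m i x],
        forall i x, m i x != x -> [set x; m i x] \in E
      & forall x, #|[set i | m i x != x]| <= deg E x].
Proof.
move=> sE [c [c_lt c_proper]].
pose P (i : 'I_k) x y := ([set x; y] \in E) && (c [set x; y] == i).
pose m i x := odflt x [pick y | P i x y].
have Puniq i x y z : P i x y -> P i x z -> y = z.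
  move=> /andP[xyE /eqP cy] /andP[xzE /eqP cz].
  have [/setP/(_ z)|ne] := eqVneq [set x; y] [set x; z].
    rewrite !inE eqxx orbT [z == x]eq_sym (negPf (loop_notin sE xzE)) /=.
    by move/eqP.
  have /(c_proper _ _ xyE xzE ne) : ~~ [disjoint [set x; y] & [set x; z]].
    by apply/pred0Pn; exists x; rewrite /= !inE eqxx.
  by rewrite cy cz eqxx.
have mP i x y : P i x y -> m i x = y.
  rewrite /m; case: pickP => [z Pz Py|/(_ y)->] //=; exact: Puniq Pz Py.
have Pm i x : m i x != x -> P i x (m i x).
  by rewrite /m; case: pickP => [z Pz|] //=; rewrite eqxx.
exists m; split.
- move=> i x; have [Ex|/Pm] := eqVneq (m i x) x; first by rewrite !Ex.
  by move=> Px; apply: mP; rewrite /P setUC.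
- move=> f x fE xf; have [y _ fxy] := pair_edge sE fE xf.
  exists (Ordinal (c_lt f fE)); rewrite [m _ x](mP _ _ y) //.
  by rewrite /P -fxy fE /=.
- by move=> i x /Pm/andP[].
move=> x; rewrite -(card_in_imset (f := fun i => [set x; m i x])).
  apply/subset_leq_card/subsetP => _ /imsetP[i + ->].
  rewrite inE => /Pm/andP[xE _].
  by rewrite inE xE !inE eqxx.
move=> i j; rewrite !inE => /Pm/andP[_ /eqP ci] /Pm/andP[_ /eqP cj] eij.
by apply: val_inj; rewrite /= -ci -cj eij.
Qed.

(** The matchings may overlap and use pairs outside [E]: each edge is coloured
    by any one of the matchings that contain it. *)
Lemma colorable_from_matchings (T : finType) (E : {set {set T}}) (k : nat)
    (m : 'I_k -> T -> T) :
    (forall i, involutive (m i)) ->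
    (forall f, f \in E -> exists i x, f = [set x; m i x]) ->
  colorable E k.
Proof.
move=> mK Em.
pose P (f : {set T}) i := [exists x, f == [set x; m i x]].
have EP f : f \in E -> exists i, P f i.
  by move=> /Em[i [x ->]]; exists i; apply/existsP; exists x.
exists (fun f => if [pick i | P f i] is Some i then val i else k); split.
  move=> f /EP[i Pi]; case: pickP => [j _|/(_ i)]; first exact: ltn_ord.
  by rewrite Pi.
have through i f x : P f i -> x \in f -> f = [set x; m i x].
  move=> /existsP[y /eqP->]; rewrite !inE => /orP[]/eqP-> //.
  by rewrite mK setUC.
move=> f g /EP[i0 Pi0] /EP[j0 Pj0] fg /pred0Pn[x /andP[/= xf xg]].
case: pickP => [i Pi|/(_ i0)]; last by rewrite Pi0.
case: pickP => [j Pj|/(_ j0)]; last by rewrite Pj0.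
apply: contra_neq fg => /val_inj ij.
by rewrite (through i f x) // ij (through j g x).
Qed.

(** In a colouring of [E] without the edges at [v], a neighbour [u] of [v] has
    lost one edge, so it misses at least [k - deg E u + 1] colours: two of them
    if [deg E u < k], one if [deg E u = k].  Distinct missing colours at the
    neighbours of [v], from [distinct_missing_colors], colour the edges at
    [v]. *)
Lemma vertex_extension (T : finType) (E : {set {set T}}) (k : nat) (v y : T) :
    simple E -> deg E v <= k ->
    (forall u, [set v; u] \in E -> deg E u <= k) ->
    (forall u, [set v; u] \in E -> u != y -> deg E u < k) ->
    colorable [set f in E | v \notin f] k ->
  colorable E k.
Proof.
move=> sE dv dN dNy; set E0 := [set f in E | v \notin f].
have sE0 : E0 \subset E by apply/subsetP => f; rewrite inE => /andP[].
case/(coloring_to_matchings (simple_sub sE0 sE)) => m [mK mE Em misE].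
pose N := [set u | [set v; u] \in E].
have NE u : (u \in N) = ([set v; u] \in E) by rewrite inE.
have cardN : #|N| <= deg E v.
  rewrite -(card_in_imset (f := fun u => [set v; u])).
    apply/subset_leq_card/subsetP => _ /imsetP[u + ->].
    by rewrite !inE => ->; rewrite eqxx.
  move=> u w; rewrite !NE => vu vw /setP/(_ u); rewrite !inE eqxx orbT.
  by rewrite eq_sym (negPf (loop_notin sE vu)) => /esym/eqP.
have vN : v \notin N by rewrite NE; apply/negP => /(loop_notin sE); rewrite eqxx.
have mv i : m i v = v.
  by apply/eqP; apply: contraT => /Em; rewrite !inE eqxx andbF.
have degN u : u \in N -> deg E0 u < deg E u.
  rewrite NE => vu; apply: proper_card; apply/properP; split.
    by apply/subsetP => f; rewrite !inE => /andP[/andP[-> _] ->].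
  by exists [set v; u]; rewrite !inE ?vu ?eqxx ?orbT //= andbF.
have mis u : k - deg E0 u <= #|missing [set: 'I_k] m u|.
  have <- : ~: [set i | m i u != u] = missing setT m u.
    by apply/setP => i; rewrite !inE negbK.
  rewrite leq_subLR -[leqLHS](card_ord k) -(cardsC [set i | m i u != u]).
  by rewrite leq_add2r misE.
have [|||m' [g [m'K rm gN gP]]] :=
  distinct_missing_colors (A := setT) (N := N) (y := y) mK.
- by rewrite cardsT card_ord (leq_trans cardN).
- move=> u uN; apply: leq_trans (mis u); rewrite subn_gt0.
  by apply: leq_trans (degN u uN) (dN u _); rewrite -NE.
- move=> u uN uy; apply: leq_trans (mis u).
  by have := degN u uN; have := dNy u; rewrite -NE => /(_ uN uy); lia.
(* Matching v with g i in colour i keeps m' i an involution, since both v and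
   g i are unmatched in m' i. *)
pose m2 i x := if x == v then odflt v (g i) else if g i == Some x then v else m' i x.
have m'v i : m' i v = v by have [pi _ ->] := rm v.
apply: (colorable_from_matchings (m := m2)).
- move=> i x; rewrite {2}/m2; have [->|xv] := eqVneq x v.
    rewrite /m2; case gi : (g i) => [u|] /=; last by rewrite eqxx.
    by rewrite eqxx; case: eqP.
  case: eqP => [gi|gi]; first by rewrite /m2 eqxx gi.
  have m'x : m' i x != v.
    by apply: contraNneq xv => E1; rewrite -(m'K i x) E1 m'v.
  rewrite /m2 (negPf m'x); case: eqP => [gi'|_]; last by rewrite m'K.
  have [_ _] := gP _ _ gi'; rewrite m'K => xE.
  by rewrite -xE in gi'.
move=> f fE; have [vf|vf] := boolP (v \in f).
  have [u _ fvu] := pair_edge sE fE vf.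
  have [|i gi] := gN u; first by rewrite NE -fvu.
  by exists i, v; rewrite /m2 eqxx gi.
have /card_gt0P[a af] : 0 < #|f| by rewrite sE.
have [||i fa] := mE f a; rewrite ?inE ?fE //.
have [pi _ Epi] := rm a; exists ((pi^-1)%g i), a.
have m'a : m' ((pi^-1)%g i) a = m i a by rewrite Epi permKV.
rewrite /m2 ifN ?ifN ?m'a //; last by apply: contraNneq vf => <-.
apply/eqP => /gP[_ _]; rewrite m'a => ma.
by have := sE f fE; rewrite fa ma setUid cards1.
Qed.

(** * Graphs whose vertices of maximum degree are independent *)

Lemma deg_gt0 (T : finType) (E : {set {set T}}) (f : {set T}) (v : T) :
  f \in E -> v \in f -> 0 < deg E v.
Proof. by move=> fE vf; apply/card_gt0P; exists f; rewrite inE fE. Qed.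

Lemma deg_le_colors (T : finType) (E : {set {set T}}) (k : nat) (v : T) :
  colorable E k -> deg E v <= k.
Proof.
case=> c [c_lt c_proper]; case: k => [|k] in c_lt *.
  rewrite leqn0 cards_eq0; apply/eqP/setP => f; rewrite !inE.
  by apply/negP => /andP[/c_lt].
rewrite /deg -[leqRHS]card_ord -(card_in_imset (f := fun f => inord (c f) : 'I_k.+1)).
  exact: max_card.
move=> f g; rewrite !inE => /andP[fE vf] /andP[gE vg] /(congr1 val) /=.
rewrite !inordK ?c_lt // => cfg; apply: contra_eq (erefl (c f)) => fg.
rewrite [X in _ != X]cfg; apply: c_proper => //.
by apply/pred0Pn; exists v; rewrite /= vf.
Qed.

(** Fournier's theorem in the case where the vertices of degree [k] are
    independent; without such vertices it is Vizing's theorem.  Induction on the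
    number of edges, removing the edges at a vertex of degree [k], or at any
    non-isolated vertex if there is none: all its neighbours have degree less
    than [k], so [vertex_extension] applies. *)
Lemma independent_core_colorable (T : finType) (E : {set {set T}}) (k : nat) :
    simple E -> (forall v, deg E v <= k) ->
    (forall u w, [set u; w] \in E -> deg E u = k -> deg E w < k) ->
  colorable E k.
Proof.
have [n] := ubnP #|E|; elim: n => // n IHn in E * => le_n sE dE indep.
have [E0|[f fE]] := set_0Vmem E.
  by exists (fun=> 0); split=> [f|f g]; rewrite E0 inE.
have [v [g gE vg] vN] : exists2 v, exists2 g, g \in E & v \in g &
    forall u, [set v; u] \in E -> deg E u < k.
  have [/exists_inP[g gE /exists_inP[v vg /eqP dv]]|/exists_inPn noE] :=
    boolP [exists g in E, [exists v in g, deg E v == k]].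
    by exists v => [|u vu]; [exists g | exact: indep dv].
  have /card_gt0P[v vf] : 0 < #|f| by rewrite sE.
  exists v => [|u vu]; first by exists f.
  have /exists_inPn/(_ u) := noE _ vu; rewrite !inE eqxx orbT => /(_ isT).
  by rewrite ltn_neqAle dE andbT.
have sub : [set h in E | v \notin h] \subset E.
  by apply/subsetP => h; rewrite inE => /andP[].
apply: (vertex_extension (v := v) (y := v)) => //; first by move=> u /vN.
apply: IHn.
- apply: leq_trans (ltnSE le_n); apply: proper_card; apply/properP; split=> //.
  by exists g; rewrite // inE vg andbF.
- exact: simple_sub sub sE.
- by move=> u; apply: leq_trans (deg_sub u sub) (dE u).
move=> u w uw du; apply: leq_ltn_trans (deg_sub w sub) _.
apply: (indep u); first exact: (subsetP sub).
by apply/eqP; rewrite eqn_leq dE -du deg_sub.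
Qed.

Lemma handshake (T : finType) (F : {set {set T}}) :
  simple F -> \sum_v deg F v = #|F|.*2.
Proof.
move=> sF; rewrite /deg.
under eq_bigr => v _ do rewrite -sum1_card.
rewrite (exchange_big_dep (mem F)) /=; last first.
  by move=> v f _; rewrite inE => /andP[].
rewrite -muln2 -sum_nat_const; apply: eq_bigr => f fF.
by rewrite -(sF f fF) -sum1_card; apply: eq_bigl => v; rewrite !inE fF.
Qed.

Lemma deg_setD (T : finType) (E F : {set {set T}}) (v : T) :
  F \subset E -> deg E v = deg F v + deg (E :\: F) v.
Proof.
move=> /setIidPr EF; rewrite /deg -(cardsID F); congr (_ + _).
  apply: eq_card => f; rewrite -[in RHS]EF !inE.
  by case: (f \in E); rewrite ?andbF //= andbC.
by apply: eq_card => f; rewrite !inE; case: (f \in F).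
Qed.

Lemma deg_setU1 (T : finType) (F : {set {set T}}) (f : {set T}) (v : T) :
  deg (f |: F) v <= (v \in f) + deg F v.
Proof.
have [vf|vf] := boolP (v \in f); last first.
  apply/subset_leq_card/subsetP => g; rewrite !inE.
  by case: eqVneq => //= ->; rewrite (negPf vf).
have -> : nat_of_bool true = #|[set f]| by rewrite cards1.
apply: leq_trans (leq_card_setU _ _).
apply/subset_leq_card/subsetP => g; rewrite !inE.
by case/andP => /orP[->|->] -> //; rewrite orbT.
Qed.

(** * Deletions that meet degree demands *)

(** When [deg E v <= D], the positive part of [deg E v - (D - 2)]. *)
Definition demand (T : finType) (D : nat) (E : {set {set T}}) (v : T) : nat :=
  (deg E v == D).*2 + (deg E v == D.-1).

Definition admissible (T : finType) (D : nat) (E F : {set {set T}}) : bool :=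
  (F \subset E) && [forall v, deg F v <= demand D E v].

(** Vertices of degree [D] left untouched by [F]. *)
Definition uncovered (T : finType) (D : nat) (E F : {set {set T}}) : {set T} :=
  [set v | (deg E v == D) && (deg F v == 0)].

(** The preference for the edge to [u] matters only in [saving_deletion]. *)
Lemma incident_edge_toward (T : finType) (E : {set {set T}}) (u : T) :
  exists h : T -> {set T}, forall w, 0 < deg E w ->
    [/\ h w \in E, w \in h w & [set u; w] \in E -> h w = [set u; w]].
Proof.
suff /fin_all_exists[h hP] w : exists f : {set T}, 0 < deg E w ->
    [/\ f \in E, w \in f & [set u; w] \in E -> f = [set u; w]] by exists h.
have [uw|uw] := boolP ([set u; w] \in E).
  by exists [set u; w]; rewrite uw !inE eqxx orbT.
have [/card_gt0P[f]|_] := boolP (0 < deg E w); last by exists set0.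
by rewrite inE => /andP[fE wf]; exists f.
Qed.

Lemma deg_lt_of_demand_met (T : finType) (E F F' : {set {set T}}) (D : nat) (v : T) :
    F \subset F' -> F' \subset E -> 0 < D -> deg E v <= D ->
    deg F v = demand D E v -> deg (E :\: F') v < D.-1.
Proof.
move=> sFF' sF'E D_gt0 dv; rewrite /demand => dF.
have := deg_setD v sF'E; have := deg_sub v sFF'; move: dF dv.
by case: eqP; case: eqP => /=; lia.
Qed.

(** [F'] adds to a maximal admissible [F] one edge [h v] at every uncovered
    vertex [v].  All degrees drop below [D], and a vertex that still has degree
    [D - 1] has [deg F] less than its demand; two such vertices are not adjacent,
    for their edge could be added to [F].  Hence the rest is [D - 1]-colourable,
    by [independent_core_colorable].  For the size, [2 #|F|] is the sum of
    [deg F], and the two units that an uncovered vertex leaves of its demand pay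
    for its edge [h v].  Any other unmet demand is a gain. *)
Lemma maximal_deletion (T : finType) (E F : {set {set T}}) (D : nat)
    (h : T -> {set T}) (F' := F :|: h @: uncovered D E F) :
    simple E -> 0 < D -> (forall v, deg E v <= D) ->
    (forall w, 0 < deg E w -> h w \in E /\ w \in h w) ->
    maxset (admissible D E) F ->
  [/\ F' \subset E, forall v, deg (E :\: F') v <= D.-1,
      colorable (E :\: F') D.-1, #|F'|.*2 <= \sum_v demand D E v &
      forall v, v \notin uncovered D E F -> deg F v < demand D E v ->
        #|F'|.*2 < \sum_v demand D E v].
Proof.
move=> sE D_gt0 dE hE /maxsetP[/andP[sFE /forallP Fle] Fmax].
have Ud v : v \in uncovered D E F -> deg E v = D /\ deg F v = 0.
  by rewrite inE => /andP[/eqP-> /eqP->].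
have hU v : v \in uncovered D E F -> h v \in E /\ v \in h v.
  by move=> /Ud[dv _]; apply: hE; rewrite dv.
have sF'E : F' \subset E.
  rewrite subUset sFE; apply/subsetP => _ /imsetP[v vU ->].
  by have [] := hU v vU.
have sFF' : F \subset F' by exact: subsetUl.
have dE' v : deg (E :\: F') v <= D.-1.
  have := deg_setD v sF'E; have := dE v; have := deg_sub v sFF'.
  have [vU|] := boolP (v \in uncovered D E F).
    have [_ vhv] := hU v vU.
    have : 0 < deg F' v by apply: deg_gt0 vhv; rewrite inE imset_f ?orbT.
    lia.
  by rewrite inE negb_and; move=> /orP[]/eqP; lia.
have core v : deg (E :\: F') v = D.-1 -> deg F v < demand D E v.
  move=> dv; rewrite ltn_neqAle Fle andbT; apply/eqP => dF.
  by have := deg_lt_of_demand_met sFF' sF'E D_gt0 (dE v) dF; rewrite dv ltnn.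
have sumF' : #|F'|.*2 <= \sum_v (deg F v + (v \in uncovered D E F).*2).
  rewrite big_split /= (handshake (simple_sub sFE sE)).
  have -> : \sum_v (v \in uncovered D E F).*2 = #|uncovered D E F|.*2.
    rewrite -muln2 -sum_nat_const [RHS]big_mkcond; apply: eq_bigr => v _.
    by case: (v \in _).
  rewrite -doubleD leq_double; apply: leq_trans (leq_card_setU _ _) _.
  by rewrite leq_add2l leq_imset_card.
have term_le v : deg F v + (v \in uncovered D E F).*2 <= demand D E v.
  have [/Ud[dv ->]|_] := boolP (v \in _); last by rewrite addn0.
  by rewrite /demand dv eqxx leq_addr.
split=> //.
- apply: independent_core_colorable => //.
    exact: simple_sub (subsetDl _ _) sE.
  move=> u w uw du; rewrite ltn_neqAle dE' andbT; apply/negP => /eqP dw.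
  move: (uw); rewrite inE => /andP[uwF' uwE].
  have : [set u; w] \notin F by apply: contra uwF'; exact: (subsetP sFF').
  rewrite -(Fmax ([set u; w] |: F)) ?setU11 ?subsetUr //.
  rewrite /admissible subUset sub1set uwE sFE; apply/forallP => x.
  apply: leq_trans (deg_setU1 _ _ _) _; rewrite !inE.
  have [->|_] := eqVneq x u; first exact: core.
  by have [->|_] := eqVneq x w; [exact: core | exact: Fle].
- by apply: leq_trans sumF' _; apply: leq_sum => v _; exact: term_le.
move=> v vU Fv; apply: leq_ltn_trans sumF' _.
rewrite (bigD1 v) // [ltnRHS](bigD1 v) //= (negPf vU) addn0 -addSn leq_add //.
by apply: leq_sum => w _; exact: term_le.
Qed.

(** The deleted edge [u v] can be kept if its ends have room for it and no other
    neighbour of [u] has degree [k]: then [v] is the only neighbour of [u] that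
    may reach degree [k], as [vertex_extension] allows. *)
Lemma edge_restoration (T : finType) (E F' : {set {set T}}) (k : nat) (u v : T) :
    simple E -> F' \subset E -> [set u; v] \in F' -> colorable (E :\: F') k ->
    (forall x, deg (E :\: F') x <= k) -> deg (E :\: F') u < k ->
    deg (E :\: F') v < k ->
    (forall w, [set u; w] \in E :\: F' -> deg (E :\: F') w < k) ->
  colorable (E :\: (F' :\ [set u; v])) k.
Proof.
move=> sE sF'E uvF' colE' dE' du dv dN.
have uvE := subsetP sF'E _ uvF'.
set H := E :\: _.
have HE : H = [set u; v] |: (E :\: F').
  apply/setP => f; rewrite !inE negb_and negbK.
  by case: eqVneq => [->|_] //=; rewrite uvE.
have degH x : deg H x <= (x \in [set u; v]) + deg (E :\: F') x.
  by rewrite HE deg_setU1.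
apply: (vertex_extension (v := u) (y := v)).
- exact: simple_sub (subsetDl _ _) sE.
- by apply: leq_trans (degH u) _; rewrite !inE eqxx.
- move=> x _; apply: leq_trans (degH x) _; rewrite !inE.
  have [->//|_] := eqVneq x u.
  by have [->//|_] := eqVneq x v; exact: dE'.
- move=> x ux xv; apply: leq_ltn_trans (degH x) _.
  have xu : x != u.
    by rewrite eq_sym (loop_notin (simple_sub (subsetDl _ _) sE) ux).
  rewrite !inE (negPf xu) (negPf xv) dN //.
  move: ux; rewrite HE => /setU1P[/setP/(_ x)|//].
  by rewrite !inE eqxx orbT (negPf xu) (negPf xv).
apply: colorable_sub colE'; apply/subsetP => f; rewrite HE !inE.
case: eqVneq => [->|_] //=; last by case/andP.
by rewrite !inE eqxx.
Qed.

(** An unmet demand outside the uncovered vertices already makes the deletion of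
    [maximal_deletion] cheaper.  Otherwise [F] has an edge [f = u v], both ends
    of which have their demand met.  Choose the extra edge of every uncovered
    neighbour of [u] to be its edge to [u].  The only vertices that keep degree
    [D - 1] are uncovered, and none of them is still adjacent to [u], so the edge
    [u v] can be put back. *)
Lemma saving_deletion (T : finType) (E F : {set {set T}}) (D : nat) :
    simple E -> 0 < D -> (forall v, deg E v <= D) ->
    maxset (admissible D E) F ->
    F != set0 \/ (exists2 v, deg E v = D.-1 & deg F v < demand D E v) ->
  exists F' : {set {set T}}, [/\ F' \subset E, colorable (E :\: F') D.-1 &
    #|F'|.*2 < \sum_v demand D E v].
Proof.
move=> sE D_gt0 dE maxF FV.
have [/existsP[v /andP[vU ltv]]|tight] :=
    boolP [exists v, (v \notin uncovered D E F) && (deg F v < demand D E v)].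
  have [h hP] := incident_edge_toward E v.
  have [|sF'E _ colE' _ /(_ v vU ltv) lt] :=
    @maximal_deletion T E F D h sE D_gt0 dE _ maxF.
    by move=> w /hP[].
  by exists (F :|: h @: uncovered D E F).
have /maxsetP[/andP[sFE /forallP Fle] _] := maxF.
have {}tight v : v \notin uncovered D E F -> deg F v = demand D E v.
  move=> vU; apply/eqP; rewrite eqn_leq Fle leqNgt; apply: contra tight => lt.
  by apply/existsP; exists v; rewrite vU.
have Ud v : v \in uncovered D E F -> deg E v = D /\ deg F v = 0.
  by rewrite inE => /andP[/eqP-> /eqP->].
have [f fF] : exists f, f \in F.
  case: FV => [/set0Pn//|[v dv]]; rewrite tight ?ltnn //.
  by rewrite inE dv; apply/negP => /andP[/eqP]; lia.
have [u uf] : exists u, u \in f.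
  by apply/card_gt0P; rewrite sE //; exact: (subsetP sFE).
have [v uv fE] := pair_edge sE (subsetP sFE _ fF) uf.
have [h hP] := incident_edge_toward E u.
have [|sF'E dE' colE' leF' _] :=
    @maximal_deletion T E F D h sE D_gt0 dE _ maxF.
  by move=> w /hP[].
set F' := F :|: h @: uncovered D E F in sF'E dE' colE' leF'.
have sFF' : F \subset F' by exact: subsetUl.
have lowdeg x : x \notin uncovered D E F -> deg (E :\: F') x < D.-1.
  by move=> /tight; exact: deg_lt_of_demand_met.
have coveredf x : x \in f -> x \notin uncovered D E F.
  move=> xf; apply/negP => /Ud[_ Fx].
  by have := deg_gt0 fF xf; rewrite Fx.
exists (F' :\ f); split.
- by apply: subset_trans sF'E; exact: subsetDl.
- rewrite fE; apply: edge_restoration => //; rewrite -?fE //.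
  + exact: (subsetP sFF').
  + exact/lowdeg/coveredf.
  + by apply/lowdeg/coveredf; rewrite fE !inE eqxx orbT.
  move=> w; rewrite inE => /andP[uwF' uwE]; apply: lowdeg.
  apply: contra uwF' => wU; have [dw _] := Ud w wU.
  have [|_ _ <-//] := hP w; first by rewrite dw.
  by rewrite inE imset_f ?orbT.
by apply: leq_trans _ leF'; rewrite ltn_double (cardsD1 f F') (subsetP sFF').
Qed.

(** * The chromatic edge stability index *)

Lemma chromatic_index_colorable (G : sgraph) :
  colorable (edges G) (chromatic_index G).
Proof.
by rewrite /chromatic_index; case: ex_minnP => k /edge_colorableP.
Qed.

Lemma chromatic_index_le (G : sgraph) (k : nat) :
  colorable (edges G) k -> chromatic_index G <= k.
Proof.
rewrite /chromatic_index; case: ex_minnP => j _ j_min colk.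
by apply: j_min; apply/edge_colorableP.
Qed.

Lemma colorable_restore (T : finType) (E : {set {set T}}) (f : {set T}) (k : nat) :
  colorable E k -> colorable (f |: E) k.+1.
Proof.
case=> c [c_lt c_proper].
exists (fun g => if g \in E then c g else k); split=> [g|g1 g2].
  by case: ifP => // /c_lt/ltnW.
move=> g1E g2E ne nd.
have [e1|n1] := boolP (g1 \in E); have [e2|n2] := boolP (g2 \in E).
- exact: c_proper.
- by rewrite ltn_eqF // c_lt.
- by rewrite gtn_eqF // c_lt.
move: g1E g2E ne; rewrite !inE (negPf n1) (negPf n2) !orbF.
by move=> /eqP-> /eqP->; rewrite eqxx.
Qed.

(** The stability index asks for a drop of exactly one.  Restoring one edge
    raises the chromatic index by at most one, so an inclusion-minimal subset of
    [F] that lowers the chromatic index lowers it by one. *)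
Lemma edge_stability_index_le (G : sgraph) (F : {set {set vertex G}}) :
    edges G != set0 -> F \subset edges G ->
    colorable (edges G :\: F) (chromatic_index G).-1 ->
  edge_stability_index G <= #|F|.
Proof.
move=> G0 sFG colF.
have chi_gt0 : 0 < chromatic_index G.
  have /set0Pn[f fG] := G0; have [c [c_lt _]] := chromatic_index_colorable G.
  exact: leq_ltn_trans (c_lt f fG).
pose P (F1 : {set {set vertex G}}) :=
  (F1 \subset F) && (chromatic_index (del_edges F1) <= (chromatic_index G).-1).
have PF : P F by rewrite /P subxx; exact: chromatic_index_le.
have [F1 /minsetP[/andP[sF1F leF1] minF1] _] := minset_exists PF.
have F1_ok : stability_witness F1.
  rewrite /stability_witness (subset_trans sF1F) // eqn_leq leF1 /= leqNgt.
  apply/negP => lt.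
  have [F10|[f fF1]] := set_0Vmem F1.
    have : chromatic_index G <= (chromatic_index G).-1.
      apply: leq_trans leF1; apply: chromatic_index_le.
      by have := chromatic_index_colorable (del_edges F1); rewrite /= F10 setD0.
    lia.
  have fG := subsetP (subset_trans sF1F sFG) _ fF1.
  have : F1 :\ f = F1.
    apply: minF1; last exact: subsetDl.
    rewrite /P (subset_trans (subsetDl _ _)) //=; apply: leq_trans lt.
    apply: chromatic_index_le => /=.
    have -> : edges G :\: (F1 :\ f) = f |: (edges G :\: F1).
      apply/setP => g; rewrite !inE negb_and negbK.
      by case: eqVneq => [->|_] //=.
    apply: colorable_restore.
    exact: (chromatic_index_colorable (del_edges F1)).
  by move/setP/(_ f); rewrite !inE eqxx fF1.
apply: (@leq_trans #|F1|); last exact: subset_leq_card.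
rewrite /edge_stability_index; case: ex_minnP => m _; apply.
by apply/existsP; exists F1; rewrite F1_ok eqxx.
Qed.

Lemma sum_demand (G : sgraph) :
  \sum_v demand (max_degree G) (edges G) v =
    (num_degree G (max_degree G)).*2 + num_degree G (max_degree G).-1.
Proof.
rewrite big_split /= /num_degree /vertices_of_degree; congr (_ + _).
  rewrite -muln2 -sum_nat_const big_mkcond [RHS]big_mkcond.
  apply: eq_bigr => v _.
  by rewrite inE; case: eqP.
rewrite -sum1_card [RHS]big_mkcond; apply: eq_bigr => v _.
by rewrite inE; case: eqP.
Qed.

Lemma chromatic_index_independent_core (G : sgraph) :
    induced_edges (vertices_of_degree G (max_degree G)) = set0 ->
  chromatic_index G <= max_degree G.
Proof.
move=> core0; apply: chromatic_index_le.
apply: independent_core_colorable; first exact: card_edge.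
  by move=> v; exact: (leq_bigmax_cond (F := @degree G)).
move=> u w uw du; rewrite ltn_neqAle [_ <= _](leq_bigmax_cond (F := @degree G)) // andbT.
apply/eqP => dw; move/setP/(_ [set u; w]): core0.
by rewrite !inE uw subUset !sub1set !inE /degree -!/(deg _ _) du dw eqxx.
Qed.

(** Since [G] is [D]-colourable, a witness leaves a graph of maximum degree less
    than [D]: it contains an edge at each vertex of degree [D], and two such
    vertices do not share an edge. *)
Lemma independent_core_stability_ge (G : sgraph) :
    edges G != set0 ->
    induced_edges (vertices_of_degree G (max_degree G)) = set0 ->
  num_degree G (max_degree G) <= edge_stability_index G.
Proof.
move=> G0 core0.
have D_gt0 : 0 < max_degree G.
  have /set0Pn[f fG] := G0; have /card_gt0P[v vf] : 0 < #|f| by rewrite (card_edge fG).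
  apply: leq_trans (leq_bigmax_cond (F := @degree G) v isT); exact: deg_gt0 fG vf.
rewrite /edge_stability_index; case: ex_minnP => m.
case/existsP => F /andP[/andP[sFG /eqP chiF] /eqP <-] _.
have hit v : degree v = max_degree G -> exists2 f, f \in F & v \in f.
  move=> dv; have : 0 < deg F v.
    have := deg_setD v sFG; rewrite -[deg _ v]/(degree v) dv.
    have := deg_le_colors v (chromatic_index_colorable (del_edges F)).
    rewrite /= chiF; have := chromatic_index_independent_core core0; lia.
  by move=> /card_gt0P[f]; rewrite inE => /andP[fF vf]; exists f.
have /fin_all_exists[h hP] v : exists f,
    v \in vertices_of_degree G (max_degree G) -> f \in F /\ v \in f.
  have [dv|dv] := eqVneq (degree v) (max_degree G); last first.
    by exists set0; rewrite inE (negPf dv).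
  by have [f fF vf] := hit v dv; exists f.
rewrite /num_degree -(card_in_imset (f := h)).
  by apply/subset_leq_card/subsetP => _ /imsetP[v /hP[hF _] ->].
move=> u w uD wD huw; have [uF uh] := hP u uD; have [_ wh] := hP w wD.
have [x xu hE] := pair_edge (@card_edge G) (subsetP sFG _ uF) uh.
move: wh; rewrite -huw hE !inE => /orP[/eqP->//|/eqP wx].
move/setP/(_ (h u)): core0; rewrite !inE (subsetP sFG) // hE -wx.
by rewrite subUset !sub1set uD wD.
Qed.

Local Open Scope ring_scope.

Theorem theorem5 (G : sgraph) (hG : edges G != set0) :
  let D := max_degree G in
  let es : rat := (edge_stability_index G)%:R in
  let bound : rat := (num_degree G D)%:R + (num_degree G (D - 1)%N)%:R / 2%:R in
  es <= bound /\
  (es = bound <->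
     num_degree G (D - 1)%N = 0%N /\
     induced_edges (vertices_of_degree G D) = set0).
Proof.
move=> D es bound; rewrite /es /bound => {es bound}; rewrite subn1.
have /set0Pn[f fG] := hG.
have degD v : (deg (edges G) v <= D)%N.
  exact: (leq_bigmax_cond (F := @degree G)).
have D_gt0 : (0 < D)%N.
  have /card_gt0P[v vf] : (0 < #|f|)%N by rewrite (card_edge fG).
  by apply: leq_trans (degD v); exact: deg_gt0 fG vf.
have sG : simple (edges G) by exact: card_edge.
have D_chi : (D <= chromatic_index G)%N.
  by apply/bigmax_leqP => v _; apply: deg_le_colors; exact: chromatic_index_colorable.
have es_le (F : {set {set vertex G}}) :
    F \subset edges G -> colorable (edges G :\: F) D.-1 ->
    (edge_stability_index G <= #|F|)%N.
  move=> sFG colF; apply: edge_stability_index_le => //.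
  by apply: colorable_le colF; lia.
set t1 := num_degree G D; set t2 := num_degree G D.-1.
set es := edge_stability_index G in es_le *.
have deg0 (v : vertex G) : deg set0 v = 0%N.
  by apply: eq_card0 => g; rewrite !inE.
have adm0 : admissible D (edges G) set0.
  by rewrite /admissible sub0set; apply/forallP => v; rewrite deg0.
have le_bound : (es.*2 <= t1.*2 + t2)%N.
  have [F maxF _] := maxset_exists adm0.
  have /card_gt0P[u _] : (0 < #|f|)%N by rewrite (card_edge fG).
  have [h hP] := incident_edge_toward (edges G) u.
  have [|sF'E _ colF' leF' _] := maximal_deletion sG D_gt0 degD _ maxF (h := h).
    by move=> w /hP[].
  rewrite -sum_demand; apply: leq_trans leF'.
  by rewrite leq_double; exact: es_le.
have lt_bound : ~ (t2 = 0 /\ induced_edges (vertices_of_degree G D) = set0)%N ->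
    (es.*2 < t1.*2 + t2)%N.
  move=> not_ext.
  (* A vertex of degree D - 1 is covered by F or has its demand unmet.  If there
     is none, F is grown from an edge e between two vertices of degree D. *)
  have [F maxF FV] : exists2 F, maxset (admissible D (edges G)) F &
    F != set0 \/
    (exists2 v, deg (edges G) v = D.-1 & (deg F v < demand D (edges G) v)%N).
    have [t20|] := eqVneq t2 0%N; last first.
      rewrite -lt0n => /card_gt0P[v]; rewrite inE => /eqP dv.
      have [F maxF _] := maxset_exists adm0; exists F => //.
      have [lt|ge] := ltnP (deg F v) (demand D (edges G) v).
        by right; exists v.
      left; apply/set0Pn; have /card_gt0P[g] : (0 < deg F v)%N.
        by apply: leq_trans ge; rewrite /demand -[deg _ v]/(degree v) dv eqxx addn1.
      by rewrite inE => /andP[gF _]; exists g.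
    have /set0Pn[e] : induced_edges (vertices_of_degree G D) != set0.
      by apply/eqP => core0; apply: not_ext.
    rewrite inE => /andP[eG /subsetP eD].
    have adme : admissible D (edges G) [set e].
      rewrite /admissible sub1set eG; apply/forallP => v.
      have := deg_setU1 set0 e v; rewrite setU0 => /leq_trans; apply.
      rewrite deg0; have [/eD|//] := boolP (v \in e).
      rewrite inE /demand => /eqP dv.
      by rewrite -[deg _ v]/(degree v) dv eqxx.
    have [F maxF sF] := maxset_exists adme; exists F => //; left.
    by apply/set0Pn; exists e; rewrite -sub1set.
  have [F' [sF'E colF' ltF']] := saving_deletion sG D_gt0 degD maxF FV.
  rewrite -sum_demand; apply: leq_ltn_trans ltF'.
  by rewrite leq_double; exact: es_le.
have natE : (t1.*2 + t2)%:R = t1%:R * 2 + t2%:R :> rat.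
  by rewrite natrD -muln2 natrM.
have esE : es.*2%:R = es%:R * 2 :> rat by rewrite -muln2 natrM.
split; first by move: le_bound; rewrite -(ler_nat rat) natE esE; lra.
split=> [eq_bound|[t20 core0]].
  have [/andP[/eqP t20 /eqP core0]|not_ext] :=
    boolP ((t2 == 0%N) && (induced_edges (vertices_of_degree G D) == set0)) => //.
  exfalso; have : (es.*2 < t1.*2 + t2)%N.
    by apply: lt_bound => -[t20 core0]; rewrite t20 core0 !eqxx in not_ext.
  by rewrite -(ltr_nat rat) natE esE; lra.
have ge_bound : (t1 <= es)%N by exact: independent_core_stability_ge.
rewrite t20 mul0r addr0; congr (_%:R).
by move: le_bound; rewrite t20; lia.
Qed.
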